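(* Let $\mathcal{F}$ be a sheaf of semilattices over a finite poset $P$ and let $\mathcal{A}\in\mathcal{H}(\mathcal{F})$. Then $\mathsf{D}^n_P(\mathcal{F},\mathcal{A})=0$ for $n=0,1$. In particular, every coextension $0\to\mathcal{A}\to\mathcal{G}\to\mathcal{F}\to0$ has a unique splitting.
   Context: **Systems and coextensions of monoids.** All monoids are commutative, written multiplicatively with unit $1$. A semilattice is a monoid with $m^2=m$ for all $m$. For a monoid $M$, a system of abelian groups $\mathcal{A}\in\mathcal{H}(M)$ consists of an abelian group $\mathcal{A}(a)$ for each $a\in M$ and homomorphisms $r_*:\mathcal{A}(a)\to\mathcal{A}(ra)$ for all $r,a\in M$ with $1_*=\mathrm{id}$ and $(rs)_*=r_*\circ s_*$; morphisms are families of homomorphisms commuting with all $r_*$. A monoid homomorphism $\varphi:M\to N$ gives $\varphi^*:\mathcal{H}(N)\to\mathcal{H}(M)$, $(\varphi^*\mathcal{A}')(a)=\mathcal{A}'(\varphi(a))$. A coextension $0\to\mathcal{A}\to N\xrightarrow{\pi}M\to0$ is a surjective monoid homomorphism $\pi:N\to M$ with an action $\bullet$ of the group $\mathcal{A}(m)$ on $\pi^{-1}(m)$ for each $m\in M$ such that (i) for $n,n'\in\pi^{-1}(m)$ there is a unique $x\in\mathcal{A}(m)$ with $n'=x\bullet n$; (ii) $(x\bullet n)(y\bullet n')=(m'_*(x)+m_*(y))\bullet(nn')$ for $x\in\mathcal{A}(m)$, $n\in\pi^{-1}(m)$, $y\in\mathcal{A}(m')$, $n'\in\pi^{-1}(m')$.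 A morphism of coextensions is a triple $(\alpha,h,\varphi)$ with $h:N\to N'$, $\varphi:M\to M'$ monoid homomorphisms, $\alpha:\mathcal{A}\to\varphi^*\mathcal{A}'$ in $\mathcal{H}(M)$, $\varphi\pi=\pi'h$ and $h(x\bullet n)=\alpha(x)\bullet h(n)$. **Sheaves.** A sheaf over a poset $P$ is a contravariant functor on $P$, $p\mapsto\mathcal{F}_p$, with maps $\phi_{p,q}:\mathcal{F}_p\to\mathcal{F}_q$ for $q\le p$. A system $\mathcal{A}\in\mathcal{H}(\mathcal{F})$ is a family $\mathcal{A}_p\in\mathcal{H}(\mathcal{F}_p)$ with morphisms $\alpha_{p,q}:\mathcal{A}_p\to\phi_{p,q}^*\mathcal{A}_q$ for $q\le p$, with $\alpha_{p,p}=\mathrm{id}$ and $\alpha_{p,r}=\phi_{p,q}^*(\alpha_{q,r})\circ\alpha_{p,q}$ for $r\le q\le p$. A coextension of $\mathcal{F}$ by $\mathcal{A}$ is a sheaf of monoids $\mathcal{G}$ with a morphism $\pi:\mathcal{G}\to\mathcal{F}$ such that each $\pi_p$ is (equipped with the structure of) a coextension of $\mathcal{F}_p$ by $\mathcal{A}_p$ and for $q\le p$ the triple $(\alpha_{p,q},\phi^{\mathcal{G}}_{p,q},\phi_{p,q})$ is a morphism of coextensions. A splitting is a morphism of sheaves of monoids $\mu:\mathcal{F}\to\mathcal{G}$ with $\pi\mu=\mathrm{id}_{\mathcal{F}}$. **Cohomology.** $C_P^{0,0}(\mathcal{F},\mathcal{A})$ is the group of functions $h$ assigning to $p\in P$,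 $x\in\mathcal{F}_p$ an element $h(p,x)\in\mathcal{A}_p(x)$. $Z^1(\mathcal{F},\mathcal{A})$ is the group of pairs $(f,g)$ with $f(p,x,y)\in\mathcal{A}_p(xy)$ for $x,y\in\mathcal{F}_p$ and $g(p,q,x)\in\mathcal{A}_q(\phi_{p,q}(x))$ for $q\le p$, $x\in\mathcal{F}_p$, such that for all $x,y,z\in\mathcal{F}_p$, $r\le q\le p$: $$0=x_*f(p,y,z)-f(p,xy,z)+f(p,x,yz)-z_*f(p,x,y),\qquad0=f(p,x,y)-f(p,y,x),$$ $$0=g(p,r,x)-\alpha_{q,r}(g(p,q,x))-g(q,r,\phi_{p,q}(x)),$$ $$0=g(p,q,xy)-y_*g(p,q,x)-x_*g(p,q,y)-f(q,\phi_{p,q}(x),\phi_{p,q}(y))+\alpha_{p,q}(f(p,x,y)),$$ where in the last line $x_*,y_*$ act as $\phi_{p,q}(x)_*,\phi_{p,q}(y)_*$. The map $\delta:C_P^{0,0}\to Z^1$ is $\delta(h)=(f_h,g_h)$, $f_h(p,x,y)=x_*h(p,y)-h(p,xy)+y_*h(p,x)$, $g_h(p,q,x)=\alpha_{p,q}(h(p,x))-h(q,\phi_{p,q}(x))$. $\mathsf{D}^0_P(\mathcal{F},\mathcal{A})=\ker\delta$ and $\mathsf{D}^1_P(\mathcal{F},\mathcal{A})=Z^1(\mathcal{F},\mathcal{A})/\mathrm{im}\,\delta$. *)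

(* Defs.v *)
From HB Require Import structures.
From mathcomp Require Import all_boot all_order all_algebra.
From mathcomp Require Import boolp.
Set Implicit Arguments.
Unset Strict Implicit.
Unset Printing Implicit Defensive.
Import Order.TTheory GRing.Theory.

Local Open Scope ring_scope.

Section DependentProduct.
Variables (I : Type) (V : I -> zmodType).
Implicit Types f g h : forall i, V i.

Let addf f g i := f i + g i.
Let oppf f i := - f i.
Let zerof i : V i := 0.

Let addfA : associative addf.
Proof. by move=> f g h; apply: functional_extensionality_dep => i; apply: addrA. Qed.
Let addfC : commutative addf.
Proof. by move=> f g; apply: functional_extensionality_dep => i; apply: addrC. Qed.
Let add0f : left_id zerof addf.
Proof. by move=> f; apply: functional_extensionality_dep => i; apply: add0r. Qed.
Let addNf : left_inverse zerof oppf addf.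
Proof. by move=> f; apply: functional_extensionality_dep => i; apply: addNr. Qed.

HB.instance Definition _ :=
  GRing.isZmodule.Build (forall i, V i) addfA addfC add0f addNf.

Definition dprod_zmod : zmodType := (forall i, V i).

Lemma dprodD (f g : dprod_zmod) i : (f + g) i = f i + g i. Proof. by []. Qed.
Lemma dprodN (f : dprod_zmod) i : (- f) i = - f i. Proof. by []. Qed.
Lemma dprod0 i : (0 : dprod_zmod) i = 0. Proof. by []. Qed.
End DependentProduct.

Section KernelCokernel.
Variables (U V : zmodType) (f : {additive U -> V}).

Definition in_kernel : {pred U} := [pred u | f u == 0].
Fact in_kernel_zmod_closed : zmod_closed in_kernel.
Proof.
split=> [|u v]; rewrite !inE ?raddf0 // => /eqP fu /eqP fv.
by rewrite raddfB fu fv subr0.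
Qed.
HB.instance Definition _ := GRing.isZmodClosed.Build U in_kernel in_kernel_zmod_closed.

Definition kernel := {u : U | u \in in_kernel}.
HB.instance Definition _ := SubChoice.on kernel.
HB.instance Definition _ := [SubChoice_isSubZmodule of kernel by <:].

Definition in_image : {pred V} := [pred v | `[< exists u, v = f u >]].
Fact in_image_zmod_closed : zmod_closed in_image.
Proof.
split=> [|v w]; rewrite !inE; first by apply/asboolP; exists 0; rewrite raddf0.
move=> /asboolP[u ->] /asboolP[u' ->].
by apply/asboolP; exists (u - u'); rewrite raddfB.
Qed.
HB.instance Definition _ := GRing.isZmodClosed.Build V in_image in_image_zmod_closed.

Definition cokernel : zmodType := Quotient.quot in_image.
End KernelCokernel.

HB.mixin Record Monoid_isCommutative M of monoid.Monoid M := {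
  cmulgC : commutative (@monoid.mul M)
}.

#[short(type="comMonoidType")]
HB.structure Definition ComMonoid :=
  {M of Monoid_isCommutative M & monoid.Monoid M}.

Reserved Notation "{ 'monoid_hom' M -> N }"
  (M at level 98, N at level 99, format "{ 'monoid_hom'  M  ->  N }").
Notation "{ 'monoid_hom' M -> N }" :=
  (UMagmaMorphism.type M N) : type_scope.

Definition is_semilattice (M : comMonoidType) := forall m : M, (m * m)%g = m.

Section Transport.
Variables (M : Type) (A : M -> zmodType).

(* [A (r * s * a)] and [A (r * (s * a))] are different types: equations
   between their elements are stated along [transport]. *)
Definition transport (a b : M) (e : a = b) (u : A a) : A b :=
  ecast c (A c) e u.

Fact transport_zmod_morphism a b (e : a = b) : zmod_morphism (transport e).
Proof. by case: b / e. Qed.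
HB.instance Definition _ a b (e : a = b) :=
  GRing.isZmodMorphism.Build (A a) (A b) (transport e)
    (transport_zmod_morphism e).
End Transport.

Record system (M : comMonoidType) := System {
  sys_obj :> M -> zmodType;
  push : forall r a : M, {additive sys_obj a -> sys_obj (r * a)%g};
  push1 : forall (a : M) (u : sys_obj a),
    push 1%g a u = transport (esym (mul1g a)) u;
  pushM : forall (r s a : M) (u : sys_obj a),
    push (r * s)%g a u
    = transport (mulgA r s a) (push r (s * a)%g (push s a u))
}.
Arguments push {M} s r {a} : rename.

Record system_mor (M : comMonoidType) (A B : system M) := SystemMor {
  sys_hom :> forall a : M, {additive A a -> B a};
  sys_hom_push : forall (r a : M) (u : A a),
    sys_hom (r * a)%g (push A r u) = push B r (sys_hom a u)
}.

Section TransportTheory.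
Variables (M : comMonoidType) (A : system M).

Lemma transport_id (a : M) (e : a = a) (u : A a) : transport e u = u.
Proof. by rewrite (eq_irrelevance e erefl). Qed.

Lemma transport_comp (a b c : M) (e : a = b) (e' : b = c) (u : A a) :
  transport e' (transport e u) = transport (etrans e e') u.
Proof. by case: c / e'; case: b / e. Qed.

Lemma transport_irr (a b : M) (e e' : a = b) (u : A a) :
  transport e u = transport e' u.
Proof. by rewrite (eq_irrelevance e e'). Qed.

Lemma push_transport (r a b : M) (e : a = b) (u : A a) :
  push A r (transport e u) = transport (congr1 (fun c => r * c)%g e) (push A r u).
Proof. by case: b / e. Qed.

Lemma push_eql (r s a : M) (e : r = s) (u : A a) :
  push A s u = transport (congr1 (fun c => c * a)%g e) (push A r u).
Proof. by case: s / e. Qed.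

Lemma push_swap (r s a b : M) (e : (s * (r * a))%g = b)
    (e' : (r * (s * a))%g = b) (u : A a) :
  transport e (push A s (push A r u)) = transport e' (push A r (push A s u)).
Proof.
have := congr1 (transport (etrans (esym (mulgA s r a)) e)) (pushM s r u).
rewrite (push_eql (cmulgC r s)) pushM !transport_comp.
rewrite (transport_irr (etrans _ (etrans _ e)) e) => <-.
exact: transport_irr.
Qed.

Lemma sys_hom_transport (B : system M) (al : system_mor A B) (a b : M)
    (e : a = b) (u : A a) :
  al b (transport e u) = transport e (al a u).
Proof. by case: b / e. Qed.
End TransportTheory.

Section Pullback.
Variables (M N : comMonoidType) (phi : {monoid_hom M -> N}) (A : system N).

Definition pullback_obj (a : M) : zmodType := A (phi a).

Definition pullback_push (r a : M) :
    {additive pullback_obj a -> pullback_obj (r * a)%g} :=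
  transport (A := A) (esym (gmulfM r a)) \o push A (phi r).

Fact pullback_push1 (a : M) (u : pullback_obj a) :
  pullback_push 1%g a u = transport (esym (mul1g a)) u.
Proof.
rewrite /pullback_push /= (push_eql (esym (gmulf1 (s := phi)))) push1.
rewrite !transport_comp.
move: (etrans _ _); case: _ / (esym (mul1g a)) => e.
by rewrite transport_id.
Qed.

Fact pullback_pushM (r s a : M) (u : pullback_obj a) :
  pullback_push (r * s)%g a u
  = transport (mulgA r s a)
      (pullback_push r (s * a)%g (pullback_push s a u)).
Proof.
rewrite /pullback_push /= (push_eql (esym (gmulfM (s := phi) r s))) pushM.
rewrite push_transport !transport_comp.
move: (push A (phi r) _) => v; move: (etrans _ _) (etrans _ _).
case: _ / (mulgA r s a) => e e'.
exact: transport_irr.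
Qed.

Definition pullback : system M := System pullback_push1 pullback_pushM.

Lemma pullback_transport (a b : M) (e : a = b) (u : pullback a) :
  transport e u = transport (A := A) (congr1 phi e) u.
Proof. by case: b / e. Qed.
End Pullback.

Section Fiber.
Variables (N M : comMonoidType) (pi : {monoid_hom N -> M}).

Definition fiber (m : M) := {n : N | pi n == m}.

Fact fiber_mul_subproof m m' (n : fiber m) (n' : fiber m') :
  pi (val n * val n')%g == (m * m')%g.
Proof. by rewrite gmulfM (eqP (valP n)) (eqP (valP n')). Qed.
Definition fiber_mul m m' (n : fiber m) (n' : fiber m') : fiber (m * m')%g :=
  exist _ (val n * val n')%g (fiber_mul_subproof n n').
End Fiber.

Section FiberMap.
Variables (N M N' M' : comMonoidType).
Variables (pi : {monoid_hom N -> M}) (pi' : {monoid_hom N' -> M'}).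
Variables (h : {monoid_hom N -> N'}) (phi : {monoid_hom M -> M'}).
Hypothesis phi_pi : forall n : N, phi (pi n) = pi' (h n).

Fact fiber_map_subproof m (n : fiber pi m) : pi' (h (val n)) == phi m.
Proof. by rewrite -phi_pi (eqP (valP n)). Qed.
Definition fiber_map m (n : fiber pi m) : fiber pi' (phi m) :=
  exist _ (h (val n)) (fiber_map_subproof n).
End FiberMap.

Record coextension (M : comMonoidType) (A : system M) (N : comMonoidType)
    (pi : {monoid_hom N -> M}) := Coextension {
  coext_surj : forall m : M, exists n : N, pi n = m;
  act : forall m : M, A m -> fiber pi m -> fiber pi m;
  act0 : forall (m : M) (n : fiber pi m), act 0 n = n;
  actD : forall (m : M) (x y : A m) (n : fiber pi m),
    act (x + y) n = act x (act y n);
  act_simply_transitive : forall (m : M) (n n' : fiber pi m),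
    exists! x : A m, n' = act x n;
  act_mul : forall (m m' : M) (x : A m) (n : fiber pi m)
      (y : A m') (n' : fiber pi m'),
    fiber_mul (act x n) (act y n')
    = act (transport (cmulgC m' m) (push A m' x) + push A m y)
          (fiber_mul n n')
}.

Record is_coextension_mor (M : comMonoidType) (A : system M)
    (N : comMonoidType) (pi : {monoid_hom N -> M}) (E : coextension A pi)
    (M' : comMonoidType) (A' : system M')
    (N' : comMonoidType) (pi' : {monoid_hom N' -> M'}) (E' : coextension A' pi')
    (phi : {monoid_hom M -> M'}) (alpha : system_mor A (pullback phi A'))
    (h : {monoid_hom N -> N'}) : Prop := IsCoextensionMor {
  coext_mor_comm : forall n : N, phi (pi n) = pi' (h n);
  coext_mor_act : forall (m : M) (x : A m) (n : fiber pi m),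
    fiber_map coext_mor_comm (act E x n)
    = act E' (alpha m x) (fiber_map coext_mor_comm n)
}.

Section Sheaves.
Context {d : Order.disp_t} {P : porderType d}.

(* A contravariant functor on P; no gluing condition is involved. The order
   relation is boolean, so proofs of r <= p are unique and quantifying over
   one instead of using transitivity changes nothing. *)
Record sheaf := Sheaf {
  sh_obj :> P -> comMonoidType;
  res : forall p q : P, (q <= p)%O -> {monoid_hom sh_obj p -> sh_obj q};
  res_id : forall (p : P) (x : sh_obj p), res (lexx p) x = x;
  res_comp : forall (p q r : P) (qp : (q <= p)%O) (rq : (r <= q)%O)
      (rp : (r <= p)%O) (x : sh_obj p),
    res rp x = res rq (res qp x)
}.
Arguments res F {p q} qp : rename.

Record sheaf_mor (F G : sheaf) := SheafMor {
  sh_hom :> forall p : P, {monoid_hom F p -> G p};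
  sh_hom_res : forall (p q : P) (qp : (q <= p)%O) (x : F p),
    sh_hom q (res F qp x) = res G qp (sh_hom p x)
}.

Record sheaf_system (F : sheaf) := SheafSystem {
  ss_obj :> forall p : P, system (F p);
  ss_map : forall (p q : P) (qp : (q <= p)%O),
    system_mor (ss_obj p) (pullback (res F qp) (ss_obj q));
  ss_map_id : forall (p : P) (x : F p) (u : ss_obj p x),
    ss_map (lexx p) x u = transport (esym (res_id x)) u;
  ss_map_comp : forall (p q r : P) (qp : (q <= p)%O) (rq : (r <= q)%O)
      (rp : (r <= p)%O) (x : F p) (u : ss_obj p x),
    ss_map rp x u
    = transport (esym (res_comp qp rq rp x))
        (ss_map rq (res F qp x) (ss_map qp x u))
}.
Arguments ss_map {F} A {p q} qp : rename.

Record sheaf_coextension (F : sheaf) (A : sheaf_system F) := SheafCoextension {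
  sc_total :> sheaf;
  sc_proj : sheaf_mor sc_total F;
  sc_coext : forall p : P, coextension (A p) (sc_proj p);
  sc_coext_mor : forall (p q : P) (qp : (q <= p)%O),
    is_coextension_mor (sc_coext p) (sc_coext q) (ss_map A qp)
      (res sc_total qp)
}.

Lemma sheaf_mor_ext (F G : sheaf) (mu nu : sheaf_mor F G) :
  (forall (p : P) (x : F p), mu p x = nu p x) -> mu = nu.
Proof.
move=> E; have {E} : sh_hom mu = sh_hom nu.
  apply: functional_extensionality_dep => p.
  have := funext (E p); case: (mu p) (nu p) => [f [[f1] [fM]]] [g [[g1] [gM]]] /=.
  move=> fg; case: g / fg g1 gM => g1 gM.
  by rewrite (Prop_irrelevance f1 g1) (Prop_irrelevance fM gM).
case: mu nu => [f fr] [g gr] /= fg; case: g / fg gr => gr.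
by rewrite (Prop_irrelevance fr gr).
Qed.

Definition is_splitting (F : sheaf) (A : sheaf_system F)
    (G : sheaf_coextension A) (mu : sheaf_mor F G) :=
  forall (p : P) (x : F p), sc_proj G p (mu p x) = x.

Section Cohomology.
Variables (F : sheaf) (A : sheaf_system F).

Definition C00 : zmodType :=
  dprod_zmod (fun p : P => dprod_zmod (fun x : F p => A p x)).

(* The ambient group of pairs (f, g), before the cocycle conditions. *)
Definition C1 : zmodType :=
  ((dprod_zmod (fun p : P =>
      dprod_zmod (fun x : F p => dprod_zmod (fun y : F p => A p (x * y)%g))))
   * (dprod_zmod (fun p : P => dprod_zmod (fun q : P =>
      dprod_zmod (fun qp : (q <= p)%O =>
        dprod_zmod (fun x : F p => A q (res F qp x)))))))%type.

Definition cocycle_assoc (c : C1) := let f := c.1 in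
  forall (p : P) (x y z : F p),
  0 = push (A p) x (f p y z)
      - transport (esym (mulgA x y z)) (f p (x * y)%g z)
      + f p x (y * z)%g
      - transport (etrans (cmulgC z (x * y)%g) (esym (mulgA x y z)))
          (push (A p) z (f p x y)).

Definition cocycle_sym (c : C1) := let f := c.1 in
  forall (p : P) (x y : F p),
  0 = f p x y - transport (cmulgC y x) (f p y x).

Definition cocycle_comp (c : C1) := let g := c.2 in
  forall (p q r : P) (qp : (q <= p)%O) (rq : (r <= q)%O) (rp : (r <= p)%O)
    (x : F p),
  0 = g p r rp x
      - transport (esym (res_comp qp rq rp x))
          (ss_map A rq (res F qp x) (g p q qp x))
      - transport (esym (res_comp qp rq rp x)) (g q r rq (res F qp x)).

(* x_* and y_* act on the system over F q through the restrictions of x, y. *)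
Definition cocycle_mul (c : C1) := let f := c.1 in let g := c.2 in
  forall (p q : P) (qp : (q <= p)%O) (x y : F p),
  let phi := res F qp in
  0 = g p q qp (x * y)%g
      - transport (etrans (cmulgC (phi y) (phi x)) (esym (gmulfM x y)))
          (push (A q) (phi y) (g p q qp x))
      - transport (esym (gmulfM x y)) (push (A q) (phi x) (g p q qp y))
      - transport (esym (gmulfM x y)) (f q (phi x) (phi y))
      + ss_map A qp (x * y)%g (f p x y).

Definition cocycle (c : C1) :=
  [/\ cocycle_assoc c, cocycle_sym c, cocycle_comp c & cocycle_mul c].

Definition in_Z1 : {pred C1} := [pred c | `[< cocycle c >]].

Fact in_Z1_zmod_closed : zmod_closed in_Z1.
Proof.
have sub2 (V : zmodType) (a a' b b' : V) :
    0 = a + b -> 0 = a' + b' -> 0 = (a - a') + (b - b').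
  by move=> h h'; rewrite addrACA -opprD -h -h' subr0.
have sub3 (V : zmodType) (a a' b b' c c' : V) :
    0 = a + b + c -> 0 = a' + b' + c' -> 0 = (a - a') + (b - b') + (c - c').
  by move=> h h'; rewrite (addrACA a) -opprD; apply: sub2.
have sub4 (V : zmodType) (a a' b b' c c' e e' : V) :
    0 = a + b + c + e -> 0 = a' + b' + c' + e' ->
    0 = (a - a') + (b - b') + (c - c') + (e - e').
  by move=> h h'; rewrite (addrACA a) -opprD; apply: sub3.
have sub5 (V : zmodType) (a a' b b' c c' e e' k k' : V) :
    0 = a + b + c + e + k -> 0 = a' + b' + c' + e' + k' ->
    0 = (a - a') + (b - b') + (c - c') + (e - e') + (k - k').
  by move=> h h'; rewrite (addrACA a) -opprD; apply: sub4.
split=> [|c c'].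
  have z1 p x y : (0 : C1).1 p x y = 0 by [].
  have z2 p q (qp : (q <= p)%O) x : (0 : C1).2 p q qp x = 0 by [].
  rewrite inE; apply/asboolP; split => f.
  - by move=> p x y z; rewrite /f !z1 !raddf0 !addr0.
  - by move=> p x y; rewrite /f !z1 !raddf0 addr0.
  - by move=> p q r qp rq rp x; rewrite /f !z2 !raddf0 !addr0.
  - by move=> g p q qp x y phi; rewrite /f /g !z1 !z2 !raddf0 !addr0.
have B1 p x y : (c - c').1 p x y = c.1 p x y - c'.1 p x y by [].
have B2 p q (qp : (q <= p)%O) x :
  (c - c').2 p q qp x = c.2 p q qp x - c'.2 p q qp x by [].
rewrite !inE => /asboolP[a1 a2 a3 a4] /asboolP[b1 b2 b3 b4].
apply/asboolP; split => f.
- move=> p x y z; rewrite /f !B1 !raddfB.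
  exact: sub4 (a1 p x y z) (b1 p x y z).
- move=> p x y; rewrite /f !B1 !raddfB.
  exact: sub2 (a2 p x y) (b2 p x y).
- move=> p q r qp rq rp x; rewrite /f !B2 !raddfB.
  exact: sub3 (a3 p q r qp rq rp x) (b3 p q r qp rq rp x).
- move=> g p q qp x y phi; rewrite /f /g !B1 !B2 !raddfB.
  exact: sub5 (a4 p q qp x y) (b4 p q qp x y).
Qed.
HB.instance Definition _ :=
  GRing.isZmodClosed.Build C1 in_Z1 in_Z1_zmod_closed.

Definition Z1 := {c : C1 | c \in in_Z1}.
HB.instance Definition _ := SubChoice.on Z1.
HB.instance Definition _ := [SubChoice_isSubZmodule of Z1 by <:].

Definition delta_f (h : C00) (p : P) (x y : F p) : A p (x * y)%g :=
  push (A p) x (h p y) - h p (x * y)%g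
  + transport (cmulgC y x) (push (A p) y (h p x)).

Definition delta_g (h : C00) (p q : P) (qp : (q <= p)%O) (x : F p) :
    A q (res F qp x) :=
  ss_map A qp x (h p x) - h q (res F qp x).

Definition delta_fun (h : C00) : C1 := (delta_f h, delta_g h).

Let section_transport (p : P) (h : forall x : F p, A p x) (x y : F p)
  (e : x = y) : h y = transport e (h x).
Proof. by case: y / e. Qed.

Fact delta_cocycle (h : C00) : delta_fun h \in in_Z1.
Proof.
rewrite inE; apply/asboolP; split => f.
- move=> p x y z; rewrite /f /= /delta_f !(raddfB, raddfD) /=.
  rewrite !pushM !push_transport !transport_comp !transport_id.
  rewrite (section_transport (h p) (mulgA x y z)) transport_comp transport_id.
  set e := etrans (cmulgC z _) _.
  have e1 : (x * (z * y))%g = (x * (y * z))%g by rewrite [(z * y)%g]cmulgC.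
  have e2 : (y * (z * x))%g = (x * (y * z))%g by rewrite mulgA cmulgC.
  rewrite (push_swap e e1) (push_swap (etrans _ e) e2).
  rewrite (transport_irr (congr1 _ _) e1) (transport_irr (etrans _ _) e2).
  rewrite !opprK !addrA.
  rewrite [RHS](ACl ((1*4)*(2*7)*(3*10)*(5*8)*(6*11)*(9*12))) /=.
  by rewrite !(subrr, addNr) !addr0.
- move=> p x y; rewrite /f /= /delta_f !(raddfB, raddfD) /=.
  rewrite transport_comp transport_id.
  rewrite -(section_transport (h p) (cmulgC y x)).
  by rewrite opprK !addrA [RHS](ACl ((1*6)*(2*5)*(3*4))) /= !(subrr, addNr) !addr0.
- move=> p q r qp rq rp x; rewrite /f /= /delta_g !raddfB /=.
  rewrite -(section_transport (h r) (esym (res_comp qp rq rp x))).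
  rewrite -(ss_map_comp qp rq rp).
  by rewrite opprK !addrA [RHS](ACl ((1*3)*(2*6)*(4*5))) /= !(subrr, addNr) !addr0.
- move=> g p q qp x y phi; rewrite /f /g /= /delta_g /delta_f.
  rewrite !(raddfB, raddfD) /= !transport_comp.
  rewrite -(section_transport (h q) (esym (gmulfM x y))).
  rewrite sys_hom_transport !sys_hom_push /=.
  rewrite pullback_transport transport_comp.
  set e := etrans _ _; rewrite (transport_irr (etrans _ (congr1 _ _)) e).
  rewrite !opprK !addrA.
  rewrite [RHS](ACl ((1*11)*(2*8)*(3*12)*(4*9)*(5*10)*(6*7))) /=.
  by rewrite !(subrr, addNr) !addr0.
Qed.

Definition delta (h : C00) : Z1 := exist _ (delta_fun h) (delta_cocycle h).

Fact delta_zmod_morphism : zmod_morphism delta.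
Proof.
move=> h h'; apply: val_inj; congr (_, _).
- apply: functional_extensionality_dep => p.
  apply: functional_extensionality_dep => x.
  apply: functional_extensionality_dep => y.
  rewrite -[RHS]/(delta_f h x y - delta_f h' x y) /delta_f !dprodD !dprodN.
  by rewrite !raddfB /= 2!opprD (addrACA _ _ (- _)) -opprD addrACA.
- apply: functional_extensionality_dep => p.
  apply: functional_extensionality_dep => q.
  apply: functional_extensionality_dep => qp.
  apply: functional_extensionality_dep => x.
  rewrite -[RHS]/(delta_g h qp x - delta_g h' qp x) /delta_g !dprodD !dprodN.
  by rewrite raddfB opprD addrACA -opprD.
Qed.
HB.instance Definition _ :=
  GRing.isZmodMorphism.Build C00 Z1 delta delta_zmod_morphism.

Definition D0 : zmodType := kernel delta.
Definition D1 : zmodType := cokernel delta.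
End Cohomology.
End Sheaves.

Arguments sheaf {d} P.
Arguments res {d P} F {p q} qp : rename.
Arguments ss_map {d P F} A {p q} qp : rename.

(* Main.v *)
From HB Require Import structures.
Require Import Defs.
From mathcomp Require Import all_boot all_order all_algebra.
From mathcomp Require Import boolp.
Import GRing.Theory.
Local Open Scope ring_scope.

(** In a semilattice [x * x = x], so [x] acts on the group over [x] itself by
    an endomorphism [e] of [A x], and [e] is idempotent because
    [x_* x_* = (x * x)_* = x_*]. For idempotent [e] the endomorphism
    [2 * e - 1] is an involution, hence bijective: [eq_double_absorb0] is its
    injectivity and [double_absorbK] exhibits its inverse. Evaluating the
    cochain formulas on the diagonal [x = y] makes this involution appear
    everywhere.

    - The diagonal of the first component of [delta h] is [(2 * e - 1) h]
      ([delta_f_diag]). Injectivity gives [D0 = 0]; surjectivity lets every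
      cocycle be corrected by a coboundary so that [f x x = 0] for all [x].
    - A symmetric cocycle [f] vanishing on the diagonal is zero
      ([alternating_cocycle0]): the cocycle identity forces
      [w = 2 * e w] for [w = f x y], with [e] now the action of [x * y]. Once
      [f = 0], the compatibility of [f] and [g] at [x = y] reads
      [g x = 2 * e (g x)], so [g = 0] as well. Hence [D1 = 0].
    - In a coextension the square of [u . n] is [2 * e u . n^2], so, again by
      bijectivity of [2 * e - 1], each fibre contains exactly one idempotent
      ([idempotent_unique], [idempotent_exists]). Homomorphisms out of a
      semilattice take idempotent values, so a splitting can only send [x] to
      the idempotent over [x]. Conversely this choice is a splitting, since
      the unit, products and restrictions of idempotents are idempotent and
      lie over the right elements. *)

(** * The action of an element on the groups it fixes *)

Lemma transport_section {M : Type} {A : M -> zmodType} (h : forall x, A x)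
    {x y : M} (e : x = y) :
  transport e (h x) = h y.
Proof. by case: y / e. Qed.

Section AbsorbingAction.
Context {M : comMonoidType} (A : system M).

(** The push-forward along [r] lands in the group over [r * a]; when [r]
    absorbs into [a] it becomes an endomorphism of the group over [a], and
    such endomorphisms can be composed and added without further transports. *)
Definition absorb {r a : M} (e : (r * a)%g = a) (u : A a) : A a :=
  transport e (push A r u).

Fact absorb_zmod_morphism {r a : M} (e : (r * a)%g = a) :
  zmod_morphism (absorb e).
Proof. by move=> u v; rewrite /absorb !raddfB. Qed.
HB.instance Definition _ {r a : M} (e : (r * a)%g = a) :=
  GRing.isZmodMorphism.Build (A a) (A a) (absorb e) (absorb_zmod_morphism e).

Lemma absorbM {r s t a : M} (er : (r * a)%g = a) (es : (s * a)%g = a)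
    (et : (t * a)%g = a) (rst : (r * s)%g = t) (u : A a) :
  absorb er (absorb es u) = absorb et u.
Proof.
case: t / rst et => et; rewrite /absorb /= pushM push_transport !transport_comp.
exact: transport_irr.
Qed.

Hypothesis hM : is_semilattice M.

Lemma absorb_idem {r a : M} (e : (r * a)%g = a) (u : A a) :
  absorb e (absorb e u) = absorb e u.
Proof. exact: absorbM (hM r) u. Qed.

(** Injectivity of [2 * e - 1]: applying [e] to [u = 2 * e u] gives
    [e u = 2 * e u], so [e u = 0] and then [u = 0]. *)
Lemma eq_double_absorb0 {r a : M} (e : (r * a)%g = a) (u : A a) :
  u = absorb e u *+ 2 -> u = 0.
Proof.
move=> uE; have Eu0 : absorb e u = 0.
  apply: (addrI (absorb e u)).
  by rewrite addr0 [in RHS]uE raddfMn /= absorb_idem mulr2n.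
by rewrite uE Eu0 mul0rn.
Qed.

(** [(2 * e - 1)^2 = 4 * e - 4 * e + 1 = 1] for idempotent [e]. This provides
    explicit solutions [v] of [2 * e v - v = u]. *)
Lemma double_absorbK {r a : M} (e : (r * a)%g = a) (u : A a) :
  let v := absorb e u *+ 2 - u in absorb e v *+ 2 - v = u.
Proof.
rewrite /= raddfB raddfMn /= absorb_idem mulr2n addrK.
by rewrite opprB addrC subrK.
Qed.

(** * Symmetric cocycles on a semilattice *)

Section Cocycle.
Variable f : forall x y : M, A (x * y)%g.

Lemma transport_cochain {x x' y y' a : M} (e : (x * y)%g = a)
    (e' : (x' * y')%g = a) :
  x = x' -> y = y' -> transport e (f x y) = transport e' (f x' y').
Proof.
by move=> ex ey; case: x' / ex e'; case: y' / ey => e'; apply: transport_irr.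
Qed.

Hypothesis fA : forall x y z,
  0 = push A x (f y z) - transport (esym (mulgA x y z)) (f (x * y)%g z)
      + f x (y * z)%g
      - transport (etrans (cmulgC z (x * y)%g) (esym (mulgA x y z)))
          (push A z (f x y)).
Hypothesis fC : forall x y, 0 = f x y - transport (cmulgC y x) (f y x).
Hypothesis fxx0 : forall x, f x x = 0.

(** With [w = f x y], write [X], [Y], [E] for the actions of [x], [y] and
    [x * y] on the group over [x * y], so that [E = Y X]. Since
    [f x x = f y y = 0], the cocycle identity at [(x, x, y)] gives
    [f x (x * y) = w - X w], and at [(x, y, y)] it gives
    [f (x * y) y = w - Y w]. Substituting both into the identity at
    [(x * y, x, y)] leaves [0 = E w - (w - Y w) - Y (w - X w)], that is
    [w = 2 * E w]. *)
Lemma alternating_cocycle0 (x y : M) : f x y = 0.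
Proof.
set a := (x * y)%g; set w : A a := f x y.
have ex : (x * a)%g = a by rewrite /a mulgA hM.
have ey : (y * a)%g = a by rewrite /a (cmulgC x) mulgA hM.
have ax : (a * x)%g = a by rewrite cmulgC.
have ay : (a * y)%g = a by rewrite cmulgC.
have ea : (a * a)%g = a := hM a.
have symE u v (e : (u * v)%g = a) (e' : (v * u)%g = a) :
    transport e (f u v) = transport e' (f v u).
  have /eqP := fC u v; rewrite eq_sym subr_eq0 => /eqP ->.
  by rewrite transport_comp; apply: transport_irr.
have fxa : transport ex (f x a) = w - absorb ex w.
  have := congr1 (transport (A := A) ex) (fA x x y).
  rewrite !(raddfB, raddfD) !raddf0 fxx0 !raddf0 addr0 /= transport_comp.
  rewrite (transport_cochain _ (erefl a) (hM x) erefl) -/w -/a.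
  rewrite -[transport ex (push A x _)]/(absorb ex w) => /esym/eqP.
  by rewrite addrC addr_eq0 opprB => /eqP.
have fay : transport ay (f a y) = w - absorb ey w.
  have := congr1 (transport (A := A) (congr1 (fun c => x * c)%g (hM y)))
    (fA x y y).
  rewrite !(raddfB, raddfD) !raddf0 fxx0 !raddf0 add0r /= raddfN /= !transport_comp.
  rewrite (transport_cochain _ ay erefl erefl).
  rewrite (transport_cochain _ (erefl a) erefl (hM y)) -/w -/a.
  rewrite (transport_irr _ ey) -[transport ey _]/(absorb ey w) => /esym/eqP.
  by rewrite -addrA addrC addr_eq0 /= opprK => /eqP.
apply: (eq_double_absorb0 ea).
(* The term f (xy) (xy) of this instance vanishes. *)
have := congr1 (transport (A := A) ea) (fA a x y).
rewrite !(raddfB, raddfD) !raddf0 fxx0 !raddf0 addr0 /= !transport_comp.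
rewrite (transport_cochain _ ay ax erefl) fay -/w.
have -> : f a x = transport (esym ax) (w - absorb ex w).
  by rewrite -fxa (symE _ _ ex ax) transport_comp transport_id.
rewrite push_transport transport_comp (transport_irr _ ey).
rewrite -[transport ey _]/(absorb ey (w - absorb ex w)).
rewrite [absorb ey (w - _)]raddfB /=.
rewrite (absorbM _ _ ea) ?[(y * x)%g]cmulgC //.
rewrite -[transport ea _]/(absorb ea w) => /esym.
rewrite !opprB -addrA [X in _ + X]addrC subrKA addrA -mulr2n => /eqP.
by rewrite subr_eq0 => /eqP ->.
Qed.
End Cocycle.
End AbsorbingAction.

(** * Idempotents in the fibres of a coextension *)

Section Idempotents.
Context {M N : comMonoidType} {A : system M} {prj : {monoid_hom N -> M}}.
Variables (E : coextension A prj) (hM : is_semilattice M).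

(** The fibres over equal elements are different types, so elements of them
    are compared through their values in the total monoid. *)
Lemma val_act_transport {m m' : M} (e : m = m') (u : A m) {n : fiber prj m}
    {n' : fiber prj m'} :
  val n = val n' -> val (act E u n) = val (act E (transport e u) n').
Proof. by case: m' / e n' => n' /val_inj ->. Qed.

Lemma act_inj {m : M} (n : fiber prj m) : injective (fun u => act E u n).
Proof.
move=> u v uv; have [w [_ wU]] := act_simply_transitive E n (act E u n).
by rewrite -(wU u) // (wU v).
Qed.

(** Squaring commutes with the action up to doubling: the multiplication
    axiom with both factors equal contributes [m_* u] twice. The square of [n]
    lies over [m * m = m]; [n2] is that square seen in the fibre over [m]. *)
Lemma sqr_act {m : M} (u : A m) (n : fiber prj m) (n2 : fiber prj m) :
  (val n * val n)%g = val n2 ->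
  (val (act E u n) * val (act E u n))%g
    = val (act E (absorb A (hM m) u *+ 2) n2).
Proof.
move=> nn; rewrite -[LHS]/(val (fiber_mul (act E u n) (act E u n))) act_mul.
rewrite (val_act_transport (n := fiber_mul n n) (hM m) _ nn); congr (val (act E _ n2)).
rewrite raddfD /= transport_comp mulr2n; congr (_ + _).
exact: transport_irr.
Qed.

(** Two idempotents of one fibre differ by some [u], and comparing squares
    gives [u = 2 * e u]. *)
Lemma idempotent_unique (n n' : N) :
  (n * n)%g = n -> (n' * n')%g = n' -> prj n = prj n' -> n = n'.
Proof.
move=> nn nn' pin.
pose k : fiber prj (prj n) := exist _ n (eqxx _).
have k'P : prj n' == prj n by rewrite pin.
pose k' : fiber prj (prj n) := exist _ n' k'P.
have [u [k'E _]] := act_simply_transitive E k k'.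
have := sqr_act u k k nn; rewrite -k'E [LHS]nn' -[LHS]/(val k') k'E.
move=> /val_inj/act_inj/(eq_double_absorb0 _ hM) u0.
by move: (congr1 val k'E); rewrite u0 act0.
Qed.

(** Start from any [n] over [m] and write [n^2 = u . n]. Then [v . n] is
    idempotent exactly when [2 * e v + u = v], which is solvable because
    [2 * e - 1] is surjective. *)
Lemma idempotent_exists (m : M) : exists n : N, prj n = m /\ (n * n)%g = n.
Proof.
have [n0 n0m] := coext_surj E m.
pose k : fiber prj m := exist _ n0 (introT eqP n0m).
have k2P : prj (n0 * n0)%g == m by rewrite gmulfM n0m hM.
pose k2 : fiber prj m := exist _ (n0 * n0)%g k2P.
have [u [k2E _]] := act_simply_transitive E k k2.
pose v := absorb A (hM m) u *+ 2 - u.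
exists (val (act E (- v) k)); split; first exact: (eqP (valP (act E (- v) k))).
rewrite (sqr_act (- v) k k2) // k2E -actD; congr (val (act E _ k)).
rewrite -[X in _ + X](double_absorbK A hM (hM m) u) -/v.
by rewrite raddfN /= mulNrn addrA addNr add0r.
Qed.
End Idempotents.

(** * Sheaves of semilattices *)

Section SheafOfSemilattices.
Context {d : Order.disp_t} {P : porderType d} {F : sheaf P}.
Variables (A : sheaf_system F) (hF : forall p : P, is_semilattice (F p)).

(** On the diagonal the coboundary is the involution [2 * e - 1], which
    governs both its kernel and the normalization of cocycles. *)
Lemma delta_f_diag (h : C00 A) (p : P) (x : F p) :
  transport (hF p x) (delta_f h x x)
    = absorb (A p) (hF p x) (h p x) *+ 2 - h p x.
Proof.
rewrite /delta_f !(raddfB, raddfD) /=.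
rewrite (transport_section (h p) (hF p x)) transport_comp.
rewrite (transport_irr (etrans _ _) (hF p x)).
by rewrite -[transport (hF p x) _]/(absorb (A p) (hF p x) (h p x)) addrAC.
Qed.

Lemma D0_eq0 (u : D0 A) : u = 0.
Proof.
apply: val_inj => /=; have /eqP du := valP u.
apply: functional_extensionality_dep => p.
apply: functional_extensionality_dep => x.
have /(congr1 (fun c => (val c).1 p x x)) := du.
move=> /(congr1 (transport (A := A p) (hF p x))).
rewrite delta_f_diag => /eqP; rewrite raddf0 subr_eq0 => /eqP/esym.
exact: eq_double_absorb0.
Qed.

(** Multiplicativity of [g] up to [f], taken at [x = y] with [f = 0], is the
    fixed-point equation of [eq_double_absorb0] for each value of [g]. *)
Lemma alternating_Z1_eq0 (c : Z1 A) :
  (forall (p : P) (x : F p), (val c).1 p x x = 0) -> c = 0.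
Proof.
move=> cxx0; have /asboolP[cA cC _ cM] := valP c.
have f0 p x y : (val c).1 p x y = 0.
  exact: (alternating_cocycle0 _ (hF p)) (cA p) (cC p) (cxx0 p) x y.
have g_transport p q qp x y (e : x = y) :
    transport (A := A q) (congr1 (res F qp) e) ((val c).2 p q qp x)
      = (val c).2 p q qp y.
  by case: y / e.
have g0 p q (qp : (q <= p)%O) x : (val c).2 p q qp x = 0.
  set w := (val c).2 p q qp x.
  pose e := congr1 (res F qp) (hF p x).
  apply: (eq_double_absorb0 _ (hF q) (hF q (res F qp x))).
  have := congr1 (transport (A := A q) e) (cM p q qp x x).
  rewrite !f0 !(raddfB, raddfD) /= !raddf0 !addr0 !transport_comp.
  rewrite [transport e _](g_transport p q qp _ _ (hF p x)) -/w.
  rewrite !(transport_irr (etrans _ _) (hF q (res F qp x))) => /esym/eqP.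
  by rewrite -addrA -opprD subr_eq0 => /eqP.
apply: val_inj; rewrite /= [LHS]surjective_pairing; congr (_, _).
- by do 3![apply: functional_extensionality_dep => ?]; apply: f0.
- by do 4![apply: functional_extensionality_dep => ?]; apply: g0.
Qed.

(** Take [h = (2 * e - 1) f x x]: by the involution property [c] and
    [delta h] have the same diagonal, so their difference is zero. *)
Lemma Z1_delta (c : Z1 A) : exists h : C00 A, c = delta h.
Proof.
pose fd p x : A p x := transport (hF p x) ((val c).1 p x x).
pose h : C00 A := fun p x => absorb (A p) (hF p x) (fd p x) *+ 2 - fd p x.
exists h; apply/eqP; rewrite -subr_eq0; apply/eqP/alternating_Z1_eq0 => p x.
rewrite -[LHS]/((val c).1 p x x - delta_f h x x); apply/eqP; rewrite subr_eq0.
apply/eqP/(can_inj (g := transport (A := A p) (esym (hF p x)))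
  (f := transport (A := A p) (hF p x))).
  by move=> u; rewrite transport_comp transport_id.
by rewrite delta_f_diag double_absorbK.
Qed.

Lemma D1_eq0 (u : D1 A) : u = 0.
Proof.
rewrite -[u]reprK -[0]reprK; apply/eqP; rewrite -Quotient.idealrBE.
apply/asboolP; exact: Z1_delta.
Qed.

Lemma splitting_unique (G : sheaf_coextension A) (mu nu : sheaf_mor F G) :
  is_splitting mu -> is_splitting nu -> mu = nu.
Proof.
move=> muK nuK; apply: sheaf_mor_ext => p x.
apply: (idempotent_unique (sc_coext G p) (hF p)); try by rewrite -gmulfM hF.
by rewrite muK nuK.
Qed.

Lemma splitting_exists (G : sheaf_coextension A) :
  exists mu : sheaf_mor F G, is_splitting mu.
Proof.
pose mu0 p x := sval (cid (idempotent_exists (sc_coext G p) (hF p) x)).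
have mu0K p x : sc_proj G p (mu0 p x) = x.
  by rewrite /mu0; case: (cid _) => n [].
have mu0I p x : (mu0 p x * mu0 p x)%g = mu0 p x.
  by rewrite /mu0; case: (cid _) => n [].
have mu0U p x n : (n * n)%g = n -> sc_proj G p n = x -> mu0 p x = n.
  move=> nn nx; apply: (idempotent_unique (sc_coext G p) (hF p)) => //.
  by rewrite mu0K nx.
have mu01 p : mu0 p 1%g = 1%g by apply: mu0U; rewrite ?mulg1 ?gmulf1.
have mu0M p : {morph mu0 p : x y / (x * y)%g}.
  move=> x y; apply: mu0U; last by rewrite gmulfM !mu0K.
  rewrite -mulgA [(mu0 p y * _)%g]cmulgC -(mulgA (mu0 p x) (mu0 p y)).
  by rewrite mu0I mulgA mu0I.
have mu0R p q (qp : (q <= p)%O) x :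
    mu0 q (res F qp x) = res G qp (mu0 p x).
  apply: mu0U; first by rewrite -gmulfM mu0I.
  by rewrite sh_hom_res mu0K.
pose mu0H p :=
  monoid.isUMagmaMorphism.Build (F p) (G p) (mu0 p) (mu01 p, mu0M p).
pose mu p : {monoid_hom F p -> G p} := HB.pack (mu0 p) (mu0H p).
by exists (@SheafMor _ _ F G mu mu0R).
Qed.
End SheafOfSemilattices.

Theorem theorem7p2 (d : Order.disp_t) (P : finPOrderType d) (F : sheaf P)
    (hF : forall p : P, is_semilattice (F p)) (A : sheaf_system F) :
  (forall u : D0 A, u = 0) /\
  (forall u : D1 A, u = 0) /\
  (forall G : sheaf_coextension A,
     exists! mu : sheaf_mor F G, is_splitting mu).
Proof.
split; first exact: D0_eq0.
split=> [|G]; first exact: D1_eq0.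
have [mu muK] := splitting_exists A hF G.
by exists mu; split=> // nu; apply: splitting_unique.
Qed.
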